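(* Let $\phi:\mathbb{R}^n\to\mathbb{R}^n$ be a diffeomorphism with Jacobian matrix $D\phi(x)$ and Jacobian determinant (in absolute value) $|J_\phi(x)|$, and let $\omega(x)$ be a non-vanishing weight on $\mathbb{R}^n$. Let $g^{ij}(x)=\big([D\phi(x)]^{-1}[D\phi(x)]^{-T}\big)_{ij}$ denote the coefficients of the inverse metric tensor induced by $\phi$, and let $\Box_{\phi,\omega}$ act on a scalar field $u$ as $$\Box_{\phi,\omega}u=\frac{1}{\omega(x)}\sum_{i,j=1}^n\frac{\partial}{\partial x_i}\left(\omega(x)\,g^{ij}(x)\frac{\partial u}{\partial x_j}\right).$$ Put $\sigma(x)=\omega(x)/|J_\phi(x)|$. Then $$\Box_{\phi,\omega}u=\Delta_\phi u+\sum_{j=1}^n\mathcal{V}_j(x)\frac{\partial u}{\partial x_j},$$ where $$\Delta_\phi u:=\frac{1}{|J_\phi(x)|}\sum_{i,j=1}^n\frac{\partial}{\partial x_i}\left(|J_\phi(x)|\,g^{ij}(x)\frac{\partial u}{\partial x_j}\right),\qquad \mathcal{V}_j(x)=\sum_{i=1}^n g^{ij}(x)\frac{\partial}{\partial x_i}\ln\sigma(x).$$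
   Context: Here $[D\phi]^{-T}$ denotes the inverse transpose of $D\phi$. The quantity $\sigma$ is called the relative density ratio; it is an analytical tool and not a restriction, so $\omega$ and $\phi$ remain independent of each other. $\Delta_\phi$ is called the purely geometric operator, associated with the Riemannian volume measure $|J_\phi|\,dx$, and the $\mathcal{V}_j$ are the coefficients of the drift field. In this statement $\Box_{\phi,\omega}$ denotes the operator in the local limit (order $\beta=1$), where it is defined through the weighted divergence formula given in the claim. *)

(* Defs.v *)
From HB Require Import structures.
From mathcomp Require Import all_boot all_order all_algebra.
From mathcomp Require Import all_classical all_reals all_analysis.

Set Implicit Arguments.
Unset Strict Implicit.
Unset Printing Implicit Defensive.

Import Order.TTheory GRing.Theory Num.Theory.
Import numFieldNormedType.Exports.

Local Open Scope classical_set_scope.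
Local Open Scope ring_scope.

Section Defs.
Variables (R : realType) (n : nat).

(* Points of R^n are row vectors; coordinates are numbered from 0. *)
Definition partial (V : normedModType R) (i : 'I_n) (f : 'rV[R]_n -> V)
    (x : 'rV[R]_n) : V :=
  'D_(delta_mx 0 i) f x.

Fixpoint classC (V : normedModType R) (k : nat) (f : 'rV[R]_n -> V) : Prop :=
  if k is k'.+1 then
    (forall x, differentiable f x) /\ (forall i, classC k' (partial i f))
  else continuous f.

Definition diffeomorphism (k : nat) (phi : 'rV[R]_n -> 'rV[R]_n) : Prop :=
  classC k phi /\
  exists psi : 'rV[R]_n -> 'rV[R]_n,
    [/\ cancel phi psi, cancel psi phi & classC k psi].

(* The library's ['J phi x] acts on row vectors from the right, so its (i, j)
   entry is d phi_j / d x_i; the transpose restores the usual convention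
   (D phi)_{ij} = d phi_i / d x_j. *)
Definition Dmx (phi : 'rV[R]_n -> 'rV[R]_n) (x : 'rV[R]_n) : 'M[R]_n :=
  ('J phi x)^T.

Definition absJ (phi : 'rV[R]_n -> 'rV[R]_n) (x : 'rV[R]_n) : R :=
  `| \det (Dmx phi x) |.

Definition ginv (phi : 'rV[R]_n -> 'rV[R]_n) (x : 'rV[R]_n) : 'M[R]_n :=
  invmx (Dmx phi x) *m (invmx (Dmx phi x))^T.

Definition box (phi : 'rV[R]_n -> 'rV[R]_n) (omega u : 'rV[R]_n -> R)
    (x : 'rV[R]_n) : R :=
  1 / omega x * \sum_(i < n) \sum_(j < n)
    partial i (fun y => omega y * ginv phi y i j * partial j u y) x.

Definition geomLaplacian (phi : 'rV[R]_n -> 'rV[R]_n) (u : 'rV[R]_n -> R)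
    (x : 'rV[R]_n) : R :=
  1 / absJ phi x * \sum_(i < n) \sum_(j < n)
    partial i (fun y => absJ phi y * ginv phi y i j * partial j u y) x.

Definition densityRatio (phi : 'rV[R]_n -> 'rV[R]_n) (omega : 'rV[R]_n -> R)
    (x : 'rV[R]_n) : R :=
  omega x / absJ phi x.

(* The absolute value is inert when sigma > 0, i.e. omega > 0. A non-vanishing
   omega may also be negative; then ln sigma is read as ln |sigma|, the real
   part of any branch of the complex logarithm, which has the same gradient.
   (The library's [ln] is constantly 0 on the negative half-line.) *)
Definition drift (phi : 'rV[R]_n -> 'rV[R]_n) (omega : 'rV[R]_n -> R)
    (j : 'I_n) (x : 'rV[R]_n) : R :=
  \sum_(i < n)
    ginv phi x i j * partial i (fun y => ln `|densityRatio phi omega y|) x.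

End Defs.

(* Main.v *)
(** Write [sigma = omega / |J|]. Each flux [omega * g * d_j u] equals
    [sigma * (|J| * g * d_j u)], and the product rule together with
    [d_i sigma = sigma * d_i (ln |sigma|)] splits its divergence into the
    geometric term and the drift term, since [sigma / omega = 1 / |J|].
    The product rule needs [|J|] and [g] to be differentiable: [D phi] has C^1
    entries and, by the chain rule for [phi^-1 \o phi = id], is invertible. *)

Require Import Defs.
From HB Require Import structures.
From mathcomp Require Import all_boot all_order all_algebra.
From mathcomp Require Import all_classical all_reals all_analysis.

Set Implicit Arguments.
Unset Strict Implicit.
Unset Printing Implicit Defensive.

Import Order.TTheory GRing.Theory Num.Theory.
Import numFieldNormedType.Exports.

Local Open Scope classical_set_scope.
Local Open Scope ring_scope.

Section DirectionalDerivatives.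
Variables (R : realType) (V : normedModType R).
Implicit Types (f : V -> R) (x v : V).

(** Both sides are limits of the same difference quotient. This reduces directional derivatives to
    one real variable. *)
Lemma derive_line f x v : 'D_v f x = 'D_1 (fun h : R => f (h *: v + x)) 0.
Proof.
rewrite /derive; set g1 := fun h => h^-1 *: _; set g2 := fun h => h^-1 *: _.
suff -> : g1 = g2 by [].
by rewrite funeqE /g1 /g2 => h /=; rewrite addr0 scale0r add0r [_%:A]mulr1.
Qed.

(** Differentiability of [f] at [x] is not assumed, only derivability along [v]: restricted to the
    line through [x], both factors depend on one real variable, where the two notions coincide. *)
Lemma is_derive_comp (g : R -> R) f x v dg :
  derivable f x v -> is_derive (f x) 1 g dg ->
  is_derive x v (g \o f) (dg * 'D_v f x).
Proof.
move=> /derivable1P df [dg1 <-]; rewrite (derive_line f).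
suff [dgf gfE] : is_derive (0 : R) (1 : R) (g \o (fun h : R => f (h *: v + x)))
    ('D_1 g (f x) * 'D_1 (fun h : R => f (h *: v + x)) 0).
  by apply: DeriveDef; [exact/derivable1P|rewrite (derive_line (g \o f))].
have [h hE] : exists h : R -> R, h = fun h : R => f (h *: v + x) by eexists.
have h0 : h 0 = f x by rewrite hE scale0r add0r.
rewrite -hE in df *; rewrite -h0 in dg1 *.
have dh' := (derivable1_diffP h 0).1 df.
have dg' := (derivable1_diffP g (h 0)).1 dg1.
apply: DeriveDef.
  exact: (derivable1_diffP (g \o h) 0).2 (differentiable_comp dh' dg').
have := derive1_comp df dg1.
by rewrite !derive1E.
Qed.

End DirectionalDerivatives.

Lemma derivable_normr (R : realType) (a : R) : a != 0 -> derivable (fun y : R => `|y|) a 1.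
Proof.
rewrite neq_lt => /orP[a0|a0].
- apply: (@near_eq_derivable _ _ _ -%R); last exact: derivable_opp.
  by near=> y; rewrite ltr0_norm//; near: y; exact: lt_nbhsl.
- apply: (@near_eq_derivable _ _ _ id); last exact: derivable_id.
  by near=> y; rewrite gtr0_norm//; near: y; exact: lt_nbhsr.
Unshelve. all: by end_near. Qed.

(** Near a negative [a] the function is [ln (- y)], and the two minus signs cancel. Hence [omega]
    may have either sign. *)
Lemma is_derive_ln_normr (R : realType) (a : R) : a != 0 ->
  is_derive a 1 (fun y : R => ln `|y|) a^-1.
Proof.
rewrite neq_lt => /orP[a0|a0].
- apply: (@near_eq_is_derive _ _ _ ((@ln R) \o (-%R : R -> R))).
    by near=> y; rewrite /= ltr0_norm//; near: y; exact: lt_nbhsl.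
  have dN : derivable (-%R : R -> R) a 1 by exact: derivable_opp.
  have dl : is_derive (- a) 1 (@ln R) (- a)^-1 by apply: is_derive1_ln; rewrite oppr_gt0.
  apply: is_derive_eq (is_derive_comp dN dl) _.
  by rewrite derive_val invrN mulrNN mulr1.
- apply: (@near_eq_is_derive _ _ _ (@ln R)); last exact: is_derive1_ln.
  by near=> y; rewrite gtr0_norm//; near: y; exact: lt_nbhsr.
Unshelve. all: by end_near. Qed.

Section DerivableMatrix.
Variables (R : realType) (V : normedModType R).
Implicit Types x v : V.

Lemma derivable_prod (I : Type) (r : seq I) (P : pred I) (F : I -> V -> R) x v :
  (forall i, derivable (F i) x v) ->
  derivable (fun y => \prod_(i <- r | P i) F i y) x v.
Proof.
move=> dF; rewrite -fct_prodE.
by elim/big_ind: _ => [|g h|i _]; [exact: derivable_cst|exact: derivableM|].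
Qed.

Lemma derivable_big_sum (I : Type) (r : seq I) (P : pred I) (F : I -> V -> R) x v :
  (forall i, derivable (F i) x v) ->
  derivable (fun y => \sum_(i <- r | P i) F i y) x v.
Proof.
move=> dF; rewrite -fct_sumE.
by elim/big_ind: _ => [|g h|i _]; [exact: derivable_cst|exact: derivableD|].
Qed.

(** By the Leibniz expansion, the determinant is a polynomial in the entries. *)
Lemma derivable_det n (A : V -> 'M[R]_n) x v :
  (forall i j, derivable (fun y => A y i j) x v) ->
  derivable (fun y => \det (A y)) x v.
Proof.
move=> dA; apply: derivable_big_sum => s; apply: derivableM.
  exact: derivable_cst.
by apply: derivable_prod => i; exact: dA.
Qed.

(** This is the cofactor formula. Invertibility at every [y] makes it an identity of functions,
    since [invmx] returns a singular matrix unchanged. *)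
Lemma derivable_invmx n (A : V -> 'M[R]_n) x v :
  (forall y, A y \in unitmx) ->
  (forall i j, derivable (fun y => A y i j) x v) ->
  forall i j, derivable (fun y => invmx (A y) i j) x v.
Proof.
move=> uA dA i j.
have -> : (fun y => invmx (A y) i j) =
          (fun y => (\det (A y))^-1 * cofactor (A y) j i).
  by apply/funext => y; rewrite /invmx uA !mxE.
apply: derivableM.
  apply: derivableV; last exact: derivable_det.
  by rewrite -unitfE -unitmxE.
apply: derivableM; first exact: derivable_cst.
apply: derivable_det => k l.
by under eq_fun do rewrite !mxE; exact: dA.
Qed.

End DerivableMatrix.

Section Diffeomorphism.
Variables (R : realType) (n : nat) (phi : 'rV[R]_n -> 'rV[R]_n).
Hypothesis phi_diffeo : diffeomorphism 2 phi.

Lemma Dmx_unit x : Dmx phi x \in unitmx.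
Proof.
have [[dphi _] [psi [phiK _ [dpsi _]]]] := phi_diffeo.
rewrite /Dmx unitmx_tr.
have JJ : 'J phi x *m 'J psi (phi x) = 1%:M; last first.
  by have [uJ _] := mulmx1_unit JJ; exact: uJ.
(* Comparing [i]-th rows means evaluating both differentials on the [i]-th basis vector. *)
apply/row_matrixP => i; rewrite !rowE mulmxA !mul_rV_lin1 mulmx1.
have := diff_comp (dphi x) (dpsi (phi x)).
have -> : psi \o phi = id by apply/funext.
move=> /(congr1 (fun f : 'rV[R]_n -> 'rV[R]_n => f (delta_mx 0 i))) dE.
by rewrite -[RHS](derive_id x (delta_mx 0 i)) deriveE.
Qed.

Lemma absJ_neq0 x : absJ phi x != 0.
Proof. by rewrite normr_eq0 -unitfE -unitmxE Dmx_unit. Qed.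

(** Here the second order of smoothness enters: the entries are components of first partials of
    [phi], themselves differentiable. *)
Lemma derivable_Dmx x v i j : derivable (fun y => Dmx phi y i j) x v.
Proof.
have [[dphi dphi'] _] := phi_diffeo.
have -> : (fun y => Dmx phi y i j) = (fun y => partial j phi y 0 i).
  by apply/funext => y; rewrite /partial deriveEjacobian// -rowE !mxE.
have dj : derivable (partial j phi) x v by exact: diff_derivable ((dphi' j).1 x).
exact: (derivable_mxP _ _ _).1 dj 0 i.
Qed.

(** Invertibility of [Dmx phi x] keeps the determinant away from 0, where the absolute value has its
    corner. *)
Lemma derivable_absJ x v : derivable (absJ phi) x v.
Proof.
have dn : derivable (fun y : R => `|y|) (\det (Dmx phi x)) 1.
  by apply: derivable_normr; rewrite -unitfE -unitmxE Dmx_unit.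
have dd : derivable (fun y => \det (Dmx phi y)) x v.
  by apply: derivable_det => i j; exact: derivable_Dmx.
by have [] := is_derive_comp dd (derivableP dn).
Qed.

Lemma derivable_ginv x v i j : derivable (fun y => ginv phi y i j) x v.
Proof.
under eq_fun do rewrite mxE.
apply: derivable_big_sum => k; under eq_fun do rewrite [_^T _ _]mxE.
by apply: derivableM; apply: derivable_invmx => *;
  [exact: Dmx_unit|exact: derivable_Dmx|exact: Dmx_unit|exact: derivable_Dmx].
Qed.

End Diffeomorphism.

Lemma derive_log_weight (R : realType) (V : normedModType R) (s F : V -> R)
    (x v : V) : s x != 0 -> derivable s x v -> derivable F x v ->
  'D_v (fun y => s y * F y) x =
  s x * ('D_v F x + F x * 'D_v (fun y => ln `|s y|) x).
Proof.
move=> s0 ds dF; rewrite [LHS](deriveM ds dF).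
have [_ ->] := is_derive_comp ds (is_derive_ln_normr s0).
rewrite mulrDr; congr (_ + _).
by rewrite mulrCA (mulrA (s x)) divff// mul1r.
Qed.

Theorem mainTheorem3 (R : realType) (n : nat)
    (phi : 'rV[R]_n -> 'rV[R]_n) (omega u : 'rV[R]_n -> R)
    (phi_diffeo : diffeomorphism 2 phi)
    (omega_C1 : classC 1 omega) (omega_neq0 : forall x, omega x != 0)
    (u_C2 : classC 2 u) (x : 'rV[R]_n) :
  box phi omega u x
  = geomLaplacian phi u x + \sum_(j < n) drift phi omega j x * partial j u x.
Proof.
have J0 := absJ_neq0 phi_diffeo.
have sigma0 y : densityRatio phi omega y != 0.
  by rewrite mulf_neq0 ?invr_eq0.
have dsigma v : derivable (densityRatio phi omega) x v.
  apply: derivableM; first exact: diff_derivable (omega_C1.1 x).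
  by apply: derivableV => //; exact: derivable_absJ.
have dF i j : derivable
    (fun y => absJ phi y * ginv phi y i j * partial j u y) x (delta_mx 0 i).
  apply: derivableM; last exact: diff_derivable ((u_C2.2 j).1 x).
  by apply: derivableM; [exact: derivable_absJ|exact: derivable_ginv].
(* The flux value at [x] is regrouped so that [absJ phi x] stands in front of a summand of the drift
   term. *)
have boxE i j : partial i (fun y => omega y * ginv phi y i j * partial j u y) x =
    densityRatio phi omega x *
    (partial i (fun y => absJ phi y * ginv phi y i j * partial j u y) x +
     absJ phi x * (ginv phi x i j *
       partial i (fun y => ln `|densityRatio phi omega y|) x * partial j u x)).
  rewrite {1}/partial.
  rewrite (_ : (fun y => _) = fun y => densityRatio phi omega y *
      (absJ phi y * ginv phi y i j * partial j u y)); last first.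
    by apply/funext => y; rewrite /densityRatio -!mulrA mulKf.
  rewrite (derive_log_weight (sigma0 x) (dsigma _) (dF i j)).
  rewrite -/(partial i _ x) -/(partial i _ x).
  by congr (_ * (_ + _)); rewrite !mulrA; exact: mulrAC.
rewrite /box.
(* The values of [densityRatio] and [absJ] at [x] do not depend on [i] and [j], so they leave both
   sums. *)
under eq_bigr do (under eq_bigr do rewrite boxE;
  rewrite -mulr_sumr big_split/= -mulr_sumr).
rewrite -mulr_sumr big_split/= -mulr_sumr mulrA.
have -> : 1 / omega x * densityRatio phi omega x = 1 / absJ phi x.
  by rewrite !mul1r mulKf.
(* The prefactor [1 / absJ phi x] stays on the geometric sum and cancels the factor [absJ phi x] of
   the other one. *)
rewrite mulrDr [in X in _ + X]mulrA mul1r mulVf// mul1r; congr (_ + _).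
  by rewrite /geomLaplacian mul1r.
(* The divergence sums over [i] outermost, whereas [drift] sums over [i] for fixed [j]. *)
rewrite exchange_big/=; apply: eq_bigr => j _.
by rewrite /drift mulr_suml.
Qed.
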